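(* Let $0<\alpha<2$ and let $\theta_1\neq\theta_2$ be constants. No ellipse with unequal semi-axes is a rotating patch for the $\alpha$-patch equation. Precisely: let $R_1\neq R_2$ be positive numbers and let $D_0$ be the region bounded by the ellipse $z_0(x)=(R_1\cos x,R_2\sin x)$, $x\in[0,2\pi]$. Then there is no real $\Omega$ such that the rigidly rotated domains $D(t)=e^{i\Omega t}D_0$ (rotation about the center of mass, the origin) form a solution of the $\alpha$-patch evolution. Equivalently, there is no real $\Omega$ such that $$\Big\langle c_\alpha\int_0^{2\pi}\frac{\partial_x z_0(x)-\partial_x z_0(x-y)}{|z_0(x)-z_0(x-y)|^{\alpha}}\,dy,\ \partial_x z_0(x)^\perp\Big\rangle=\big\langle i\Omega z_0(x),\ \partial_x z_0(x)^\perp\big\rangle\quad\text{for all }x\in[0,2\pi],$$ where $iz$ denotes the rotation of $z$ by $\pi/2$.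
   Context: The $\alpha$-patch problem: $\theta(x,t)=\theta_1$ on a bounded simply connected domain $D(t)\subset\mathbb R^2$ and $\theta_2$ on its complement, transported by the velocity $v=\nabla^\perp(-\Delta)^{-(1-\alpha/2)}\theta$. Parametrizing the boundary $\partial D(t)$ by a $2\pi$-periodic curve $z(x,t)$, the evolution (up to tangential reparametrization, which does not change the domain) is $$\partial_t z(x,t)=c_\alpha\int_0^{2\pi}\frac{\partial_x z(x,t)-\partial_x z(x-y,t)}{|z(x,t)-z(x-y,t)|^{\alpha}}\,dy,\qquad c_\alpha=-\frac{(\theta_2-\theta_1)\Gamma(\alpha/2)}{\pi^2 2^{2-\alpha}\Gamma(\frac{2-\alpha}{2})}.$$ Only the normal component of the velocity determines the evolution of the domain. A rotating patch is a solution whose domain at time $t$ is the initial domain rotated by angle $\Omega t$ about its center of mass, for a constant angular velocity $\Omega$; $\partial_x z^\perp$ denotes the normal vector obtained by rotating $\partial_x z$ by $\pi/2$. *)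

(* Defs.v *)
From HB Require Import structures.
From mathcomp Require Import all_boot all_order all_algebra.
From mathcomp Require Import all_classical all_reals all_analysis.
Set Implicit Arguments. Unset Strict Implicit. Unset Printing Implicit Defensive.
Import Order.TTheory GRing.Theory Num.Theory.
Local Open Scope classical_set_scope.
Local Open Scope ring_scope.

Section AlphaPatch.
Variable R : realType.

Definition Gamma (s : R) : R :=
  Rintegral lebesgue_measure `]0, +oo[%classic
    (fun t : R => t `^ (s - 1) * expR (- t)).

Definition c_alpha (alpha theta1 theta2 : R) : R :=
  - ((theta2 - theta1) * Gamma (alpha / 2)) /
    (pi ^+ 2 * (2 `^ (2 - alpha)) * Gamma ((2 - alpha) / 2)).

Definition dot (u v : R * R) : R := u.1 * v.1 + u.2 * v.2.
Definition euclid (u : R * R) : R := Num.sqrt (u.1 ^+ 2 + u.2 ^+ 2).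
(* rotation by pi/2: u^perp, also multiplication by i *)
Definition perp (u : R * R) : R * R := (- u.2, u.1).

Definition ell (R1 R2 x : R) : R * R := (R1 * cos x, R2 * sin x).
Definition dell (R1 R2 x : R) : R * R := (- (R1 * sin x), R2 * cos x).

Definition patch_integrand (R1 R2 alpha x : R) (comp : R * R -> R) (y : R) : R :=
  (comp (dell R1 R2 x) - comp (dell R1 R2 (x - y))) /
    (euclid (ell R1 R2 x - ell R1 R2 (x - y))%R) `^ alpha.

Definition patch_velocity (alpha theta1 theta2 R1 R2 x : R) : R * R :=
  (c_alpha alpha theta1 theta2 *
     Rintegral lebesgue_measure `[0, 2 * pi]%classic
       (patch_integrand R1 R2 alpha x fst),
   c_alpha alpha theta1 theta2 *
     Rintegral lebesgue_measure `[0, 2 * pi]%classic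
       (patch_integrand R1 R2 alpha x snd)).

End AlphaPatch.

(* Main.v *)
Require Import Defs.
From HB Require Import structures.
From mathcomp Require Import all_boot all_order all_algebra.
From mathcomp Require Import all_classical all_reals all_analysis.
From mathcomp Require Import measurable_realfun ring lra.
Import Order.TTheory GRing.Theory Num.Theory.
Import numFieldNormedType.Exports.
Local Open Scope classical_set_scope.
Local Open Scope ring_scope.

(** Put [p = alpha / 2], [A = (R1^2 + R2^2) / 2] and [B = (R1^2 - R2^2) / 2].  The
    chord of the ellipse satisfies
    [|z(x) - z(x-y)|^2 = (2 - 2 cos y) (A - B cos (2x - y))], so the normal component
    of the velocity at [x] is [c_alpha R1 R2 F(2x)] with
    [F(u) = \int_0^{2 pi} sin y (2 - 2 cos y)^-p (A - B cos (u - y))^-p dy].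
    For a rotating patch it is a multiple of [sin 2x], which forces
    [F(u) = F(pi - u)].  Folding the integral along [y |-> 2 pi - y] and then
    [y |-> pi - y] shows that [F(u) - F(pi - u)] is the integral over [0 < y < pi/2] of
    [sin y ((2 - 2 cos y)^-p - (2 + 2 cos y)^-p) (h(u - y) - h(u + y))], where
    [h(w) = (A - B cos w)^-p + (A + B cos w)^-p] is strictly increasing in
    [|B cos w|].  For [0 < u < pi/2] this integrand is positive, a contradiction.
    Since [Rintegral] is [0] on a function with infinite integral, the integrability of
    the two components of the velocity and of the integrand of [Gamma] is needed too;
    these singular functions are dominated by derivatives of bounded functions. *)

(** * Integrability and positivity criteria *)

Section RealAnalysis.
Set Implicit Arguments. Unset Strict Implicit. Unset Printing Implicit Defensive.
Context {R : realType}.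
Notation mu := (@lebesgue_measure R).

(** The fundamental theorem of calculus bounds the integral over each compact interval by [2 * M],
    and monotone convergence carries this bound to [D]. The function [f] may thus be singular at the
    ends of [D]. *)
Lemma integrable_bounded_primitive (D : set R) (a b : R^nat) (f F : R -> R) (M : R) :
  D = \bigcup_n `[a n, b n]%classic -> nondecreasing_seq (fun n => `[a n, b n]%classic) ->
  (forall n, a n < b n) ->
  (forall x, D x -> {for x, continuous f}) -> (forall x, D x -> 0 <= f x) ->
  (forall x, D x -> is_derive x 1 F (f x)) -> (forall x, D x -> `|F x| <= M) ->
  mu.-integrable D (EFin \o f).
Proof.
move=> DE nd ab cf f0 dF FM.
have inD n x : `[a n, b n]%classic x -> D x by move=> h; rewrite DE; exists n.
have cfn n : {within `[a n, b n], continuous f}.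
  by apply: continuous_in_subspaceT => x; rewrite inE => /inD/cf.
have mfn n : measurable_fun `[a n, b n]%classic f.
  exact: subspace_continuous_measurable_fun.
have mD : measurable D by rewrite DE; apply: bigcupT_measurable.
have mf : measurable_fun D f.
  by rewrite DE; apply/measurable_fun_bigcup.
apply/integrableP; split; first exact/measurable_EFinP.
have -> : (\int[mu]_(x in D) `|(EFin \o f) x| = \int[mu]_(x in D) (EFin \o f) x)%E.
  apply: eq_integral => x; rewrite inE => Dx /=.
  by rewrite ger0_norm// f0.
apply: (@le_lt_trans _ _ (2 * M)%:E); last exact: ltry.
have cv : (\int[mu]_(x in `[a n, b n]%classic) (EFin \o f) x @[n --> \oo] -->
    \int[mu]_(x in \bigcup_n `[a n, b n]%classic) (EFin \o f) x)%E.
  apply: (@ge0_nondecreasing_set_cvg_integral _ (measurableTypeR R) R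
    (fun n => `[a n, b n]%classic) (EFin \o f) mu) => //.
  - by move=> n; have /measurable_EFinP := mfn n.
  - by move=> n x /inD/f0 h; rewrite lee_fin.
rewrite DE -(cvg_lim _ cv)//; apply: lime_le; first by apply/cvg_ex; eexists; exact: cv.
apply: nearW => n /=.
rewrite (@continuous_FTC2 _ f F)//.
- rewrite -EFinB lee_fin (le_trans (ler_norm _))// (le_trans (ler_normB _ _))//.
  rewrite mulr_natl mulr2n lerD// FM//; apply: (inD n) => /=; rewrite in_itv/= lexx ?andbT ltW//.
- have : {within `[a n, b n], continuous F}.
    apply: derivable_within_continuous => x xab.
    by have [] := dF _ (inD n x xab).
  move=> /(continuous_within_itvP _ (ab n)) [_ Fa Fb]; split => // x xab.
  have [] // : is_derive x 1 F (f x).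
  by apply/dF/(inD n); move: xab; rewrite /= !in_itv/= => /andP[? ?]; rewrite !ltW.
- move=> x xab; rewrite derive1E; have [] // : is_derive x 1 F (f x).
  by apply: dF; apply: (inD n); move: xab; rewrite /= !in_itv/= => /andP[? ?]; rewrite !ltW.
Qed.

(** A zero integral would make [f] vanish almost everywhere on [D]; as [f] vanishes nowhere there,
    [D] would lie in a null set. *)
Lemma Rintegral_gt0 (D : set R) (f : R -> R) : measurable D -> (0 < mu D)%E ->
  (forall x, D x -> 0 < f x) -> mu.-integrable D (EFin \o f) ->
  0 < \int[mu]_(x in D) f x.
Proof.
move=> mD D0 f0 fi.
have fge0 x : D x -> 0 <= f x by move=> /f0/ltW.
rewrite lt_neqAle Rintegral_ge0// andbT; apply/eqP => I0.
have mf := measurable_int _ fi.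
have /(ae_eq_integral_abs mu mD mf) : (\int[mu]_(x in D) `|(EFin \o f) x| = 0)%E.
  have -> : (\int[mu]_(x in D) `|(EFin \o f) x| = \int[mu]_(x in D) (EFin \o f) x)%E.
    by apply: eq_integral => x; rewrite inE => Dx /=; rewrite ger0_norm// fge0.
  rewrite -[LHS]fineK; last exact: integrable_fin_num.
  by rewrite [X in X%:E](_ : _ = 0)//.
move=> [N [mN N0 sub]].
have DN : D `<=` N.
  move=> x Dx; apply: sub => /= /(_ Dx) [fx0].
  by have := f0 _ Dx; rewrite fx0 ltxx.
have DN0 : (mu D <= mu N)%E by apply: le_measure; rewrite ?inE.
by move: D0; rewrite ltNge (le_trans DN0)// -[X in (_ <= X)%E]N0.
Qed.

(** * Reflecting and folding integrals *)

Lemma lebesgue_measure_reflect (c : R) (A : set R) : measurable A ->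
  mu A = mu ((fun y => c - y) @^-1` A).
Proof.
have mphi : measurable_fun [set: measurableTypeR R] (fun y : R => (c - y : measurableTypeR R)).
  exact: measurable_funB.
move=> mA.
have -> : mu ((fun y => c - y) @^-1` A) =
    pushforward mu (fun y : measurableTypeR R => (c - y : measurableTypeR R)) A by [].
(* By uniqueness it suffices to compare lengths of half-open intervals, for which the reflection
   only exchanges the open and the closed end. *)
apply: lebesgue_measure_unique mA.
move=> X [[x y] _ <-] /=; rewrite /pushforward.
have -> : (fun z => c - z) @^-1` `]x, y]%classic = `[c - y, c - x[%classic.
  by apply/seteqP; split => z /=; rewrite !in_itv/= => /andP[? ?]; apply/andP; split; lra.
rewrite !lebesgue_measure_itv /= !lte_fin ltrD2l ltrN2; case: ifP => // _.
by rewrite -!EFinB; congr (_%:E); ring.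
Qed.

Lemma integrable_EFinD (D : set R) (f g : R -> R) : measurable D ->
  mu.-integrable D (EFin \o f) -> mu.-integrable D (EFin \o g) ->
  mu.-integrable D (EFin \o (fun y => f y + g y)).
Proof.
move=> mD fi gi.
have : mu.-integrable D ((EFin \o f) \+ (EFin \o g))%E by exact: integrableD.
exact: eq_integrable.
Qed.

Lemma integrable_EFinZ (D : set R) (k : R) (f : R -> R) : measurable D ->
  mu.-integrable D (EFin \o f) -> mu.-integrable D (EFin \o (fun y => k * f y)).
Proof.
move=> mD fi.
have : mu.-integrable D (fun y => k%:E * (EFin \o f) y)%E by exact: integrableZl.
exact: eq_integrable.
Qed.

Lemma measurable_reflect (c : R) :
  measurable_fun [set: measurableTypeR R]
    (fun y : measurableTypeR R => (c - y : measurableTypeR R)).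
Proof. exact: measurable_funB. Qed.

(** Replacing the measure by its equal image under the reflection turns the change of variables into
    an instance of integration against a pushforward. *)
Lemma integral_reflect_pushforward (c : R) (D : set R) (f : R -> \bar R) :
  (\int[mu]_(y in D) f y =
   \int[pushforward mu (fun y : measurableTypeR R => (c - y)%R : measurableTypeR R)]_(y in D)
     f y)%E.
Proof.
apply: eq_measure_integral; first exact: measurable_reflect.
by move=> mphi A mA _; rewrite /= (lebesgue_measure_reflect c).
Qed.

Lemma integrable_reflect (c : R) (D : set R) (f : R -> R) : measurable D ->
  measurable_fun [set: R] f -> mu.-integrable D (EFin \o f) ->
  mu.-integrable ((fun y => c - y) @^-1` D) (EFin \o (fun y => f (c - y))).
Proof.
move=> mD mf /integrableP[_ fi]; apply/integrableP; split.
  apply/measurable_EFinP; apply: measurable_funTS.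
  by apply: measurableT_comp => //; exact: measurable_reflect.
apply: le_lt_trans fi.
rewrite [leRHS](integral_reflect_pushforward c) ge0_integral_pushforward//.
- exact: measurable_reflect.
- by apply: measurableT_comp => //; apply/measurable_EFinP; exact: measurable_funTS.
Qed.

Lemma Rintegral_reflect (c : R) (D : set R) (f : R -> R) : measurable D ->
  measurable_fun [set: R] f -> mu.-integrable D (EFin \o f) ->
  \int[mu]_(y in D) f y = \int[mu]_(y in (fun y => c - y) @^-1` D) f (c - y).
Proof.
move=> mD mf fi; rewrite /Rintegral; congr fine.
rewrite [LHS](integral_reflect_pushforward c) integral_pushforward//.
- exact: measurable_reflect.
- exact/measurable_EFinP.
- exact: integrable_reflect.
Qed.

(** The interval is cut at its midpoint [a] and the right half is reflected onto the left one. *)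
Lemma Rintegral_fold (a b : R) (f : R -> R) : 0 < a -> b = 2 * a ->
  measurable_fun [set: R] f -> mu.-integrable `[0, b]%classic (EFin \o f) ->
  mu.-integrable `[0, a]%classic (EFin \o (fun y => f y + f (b - y))) /\
  \int[mu]_(y in `[0, b]%classic) f y =
  \int[mu]_(y in `[0, a]%classic) (f y + f (b - y)).
Proof.
move=> a0 b2a mf fi.
have sub1 : `[0, a]%classic `<=` `[0, b]%classic.
  by move=> y /=; rewrite !in_itv/= => /andP[? ?]; apply/andP; split; lra.
have refl : (fun y => b - y) @^-1` `[a, b]%classic = `[0, a]%classic.
  by apply/seteqP; split => y /=; rewrite !in_itv/= => /andP[? ?]; apply/andP; split; lra.
(* The two pieces must be disjoint, so the right one omits [a]; its reflection then omits [a] as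
   well, which costs only a null set. *)
have reflo : (fun y => b - y) @^-1` `]a, b]%classic = `[0, a[%classic.
  by apply/seteqP; split => y /=; rewrite !in_itv/= => /andP[? ?]; apply/andP; split; lra.
have i1 : mu.-integrable `[0, a]%classic (EFin \o f) by apply: integrableS fi.
have i2 : mu.-integrable `[a, b]%classic (EFin \o f).
  apply: integrableS fi => // y /=.
  by rewrite !in_itv/= => /andP[? ?]; apply/andP; split; lra.
have i2o : mu.-integrable `]a, b]%classic (EFin \o f).
  by apply: integrableS i2 => //; exact: subset_itv_oc_cc.
have i3 : mu.-integrable `[0, a]%classic (EFin \o (fun y => f (b - y))).
  by rewrite -refl; exact: integrable_reflect.
have i3o : mu.-integrable `[0, a[%classic (EFin \o (fun y => f (b - y))).
  by apply: integrableS i3 => //; exact: subset_itv_co_cc.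
split; first exact: integrable_EFinD.
rewrite RintegralD// -(@Rintegral_itv_bndo_bndc R _ _ _ i3o) -reflo -Rintegral_reflect//.
have U : `[0, b]%classic = `[0, a]%classic `|` `]a, b]%classic :> set R.
  by rewrite -itv_bndbnd_setU// bnd_simp; lra.
rewrite {1}U Rintegral_setU// -?U//.
apply/disj_setPS => y [] /=; rewrite !in_itv/= => /andP[_ h] /andP[/lt_le_trans/(_ h)].
by rewrite ltxx.
Qed.

(** * The bounded-primitive criterion on open intervals and on the half-line *)

Lemma bigcup_itv_oo (L : R) : 0 < L ->
  `]0, L[%classic = \bigcup_n `[L / n.+3%:R, L - L / n.+3%:R]%classic.
Proof.
move=> L0; apply/seteqP; split => x /=.
  rewrite in_itv/= => /andP[x0 xL]; pose m := Num.min x (L - x).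
  have m0 : 0 < m by rewrite lt_min x0 subr_gt0.
  exists (Num.truncn (L / m)) => //=; set n := Num.truncn _.
  have nm : L / n.+3%:R <= m.
    rewrite ler_pdivrMr ?ltr0n// mulrC -ler_pdivrMr//.
    by rewrite (le_trans (ltW (truncnS_gt _)))// ler_nat ltnW.
  have : m <= x by rewrite ge_min lexx.
  have : m <= L - x by rewrite ge_min lexx orbT.
  rewrite in_itv/= => mL mx; rewrite (le_trans nm mx)/=.
  by move: (le_trans nm mL); set e := L / _ => ?; lra.
move=> [n _] /=; rewrite !in_itv/= => /andP[h1 h2].
have : 0 < L / n.+3%:R by rewrite divr_gt0 ?ltr0n.
by move: h1 h2; set e := L / _ => *; apply/andP; split; lra.
Qed.

Lemma bigcup_itv_oy :
  `]0, +oo[%classic = \bigcup_n `[n.+2%:R^-1, n.+2%:R]%classic :> set R.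
Proof.
apply/seteqP; split => x /=.
  rewrite in_itv/= andbT => x0; pose m := Num.max x (x^-1).
  have xm : x <= m by rewrite le_max lexx.
  have xm' : x^-1 <= m by rewrite le_max lexx orbT.
  exists (Num.truncn m) => //=; set n := Num.truncn _.
  have nm : m <= n.+2%:R by rewrite (le_trans (ltW (truncnS_gt _)))// ler_nat ltnW.
  rewrite in_itv/= (le_trans xm)// andbT -[leRHS]invrK lef_pV2 ?posrE ?invr_gt0 ?ltr0n//.
  exact: le_trans nm.
move=> [n _] /=; rewrite !in_itv/= => /andP[h1 h2].
by rewrite andbT (lt_le_trans _ h1)// invr_gt0 ltr0n.
Qed.

Lemma integrable_bounded_primitive_oo (L : R) (f F : R -> R) (M : R) : 0 < L ->
  (forall x, 0 < x < L -> {for x, continuous f}) -> (forall x, 0 < x < L -> 0 <= f x) ->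
  (forall x, 0 < x < L -> is_derive x 1 F (f x)) -> (forall x, 0 < x < L -> `|F x| <= M) ->
  mu.-integrable `]0, L[%classic (EFin \o f).
Proof.
move=> L0 cf f0 dF FM.
have inD x : `]0, L[%classic x -> 0 < x < L by rewrite /= in_itv.
apply: (@integrable_bounded_primitive _ _ _ f F M (bigcup_itv_oo L0)) => //.
- move=> m n mn; rewrite subsetEset => x /=; rewrite !in_itv/= => /andP[h1 h2].
  have : L / n.+3%:R <= L / m.+3%:R by rewrite ler_pM2l// lef_pV2 ?posrE ?ltr0n// ler_nat.
  by move: h1 h2; set e := L / _; set e' := L / _ => *; apply/andP; split; lra.
(* The offsets start at [L / 3], below [L / 2], so that no interval degenerates. *)
- move=> n; rewrite ltrBrDr.
  have : L / n.+3%:R < L / 2 by rewrite ltr_pM2l// ltf_pV2 ?posrE ?ltr0n// ltr_nat.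
  by set e := L / _.+3%:R; lra.
Qed.

Lemma integrable_bounded_primitive_oy (f F : R -> R) (M : R) :
  (forall x : R, 0 < x -> {for x, continuous f}) -> (forall x : R, 0 < x -> 0 <= f x) ->
  (forall x : R, 0 < x -> is_derive x 1 F (f x)) -> (forall x : R, 0 < x -> `|F x| <= M) ->
  mu.-integrable `]0, +oo[%classic (EFin \o f).
Proof.
move=> cf f0 dF FM.
have inD (x : R) : `]0, +oo[%classic x -> 0 < x by rewrite /= in_itv/= andbT.
apply: (@integrable_bounded_primitive _ _ _ f F M bigcup_itv_oy) => //.
- move=> m n mn; rewrite subsetEset => x /=; rewrite !in_itv/= => /andP[h1 h2].
  rewrite (le_trans _ h1) ?lef_pV2 ?posrE ?ltr0n ?ler_nat//=.
  by rewrite (le_trans h2)// ler_nat.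
- move=> n; rewrite (@le_lt_trans _ _ 1)//; last by rewrite ltr1n.
  by rewrite invf_le1 ?ltr0n// ler1n.
- by move=> x /inD/cf.
- by move=> x /inD/f0.
- by move=> x /inD/dF.
- by move=> x /inD/FM.
Qed.

(** * Positivity of the Gamma function on ]0, 1] *)

Lemma le_powR_1D (s t : R) : 0 < s -> s <= 1 -> 0 <= t -> t `^ s <= 1 + t.
Proof.
move=> s0 s1 t0; have [t1|/ltW t1] := leP t 1.
  rewrite (@le_trans _ _ (1 `^ s))//; last by rewrite powR1 lerDl.
  by rewrite ge0_ler_powR// ?nnegrE// ltW.
by rewrite (le_trans (ler1_powR _ _))// lerDr.
Qed.

Lemma integrable_Gamma_integrand (s : R) : 0 < s -> s <= 1 ->
  mu.-integrable `]0, +oo[%classic (EFin \o (fun t => t `^ (s - 1) * expR (- t))).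
Proof.
move=> s0 s1.
(* [f] is the derivative of [- (1 + t^s)^-1], and [(1 + t^s)^2 <= (2 + t)^2 <= 4 e^t]. *)
pose f t := s * t `^ (s - 1) * (1 + t `^ s) ^- 2.
pose F t := - (1 + t `^ s)^-1.
have pos (t : R) : 0 < 1 + t `^ s by rewrite ltr_wpDr// powR_ge0.
have fi : mu.-integrable `]0, +oo[%classic (EFin \o f).
  apply: (@integrable_bounded_primitive_oy f F 1).
  - move=> t t0.
    have c1 r : {for t, continuous (fun t => t `^ r)}.
      apply: differentiable_continuous; apply/derivable1_diffP; apply: ex_derive.
      exact: is_derive1_powR.
    apply: cvgM; first by apply: cvgM; [exact: cvg_cst|exact: c1].
    apply: cvgV; first by rewrite expf_neq0// gt_eqF.
    apply: (@cvg_comp _ _ _ _ (@GRing.exp R ^~ 2)); last exact: exprn_continuous.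
    by apply: cvgD; [exact: cvg_cst|exact: c1].
  - move=> t t0; rewrite !mulr_ge0 ?powR_ge0 ?invr_ge0 ?exprn_ge0 ?(ltW (pos _))//; exact: ltW.
  - move=> t t0; have h := is_derive1_powR s t0; rewrite /F.
    have h1 : is_derive t 1 (fun t => 1 + t `^ s) (0 + s * t `^ (s - 1)).
      exact: is_deriveD.
    have /is_deriveN h2 := is_deriveV (f := fun t => 1 + t `^ s) (lt0r_neq0 (pos t)) h1.
    apply: (is_derive_eq h2); rewrite /f add0r scaleNr opprK; exact: mulrC.
  - move=> t t0; rewrite normrN gtr0_norm ?invr_gt0// invf_le1//.
    by rewrite lerDl powR_ge0.
apply: (@le_integrable _ _ _ mu _ _ _ (EFin \o (fun t => 4 / s * f t))) => //.
- apply/measurable_EFinP; apply: measurable_funTS; apply: measurable_funM.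
    exact: measurable_powR.
  apply: measurableT_comp; [exact: measurable_expR|exact: oppr_measurable].
- move=> t; rewrite /= in_itv/= andbT => t0.
  have bnd : expR (- t) <= 4 * (1 + t `^ s) ^- 2.
    rewrite expRN -[4]invrK -invfM lef_pV2 ?posrE ?mulr_gt0 ?invr_gt0 ?exprn_gt0 ?expR_gt0//.
    (* This is the square of [1 + t / 2 <= expR (t / 2)]. *)
    have e : (1 + t / 2) ^+ 2 <= expR t.
      have -> : expR t = expR (t / 2) ^+ 2 by rewrite -expRM_natl; congr expR; field.
      rewrite ler_pXn2r// ?nnegrE ?expR_ge0 ?expR_ge1Dx//; lra.
    apply: le_trans e.
    have -> : (1 + t / 2) ^+ 2 = 4^-1 * (2 + t) ^+ 2 by field.
    rewrite ler_pM2l ?invr_gt0// ler_pXn2r// ?nnegrE ?(ltW (pos _))//;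
    have := le_powR_1D s0 s1 (ltW t0); lra.
  rewrite !ger0_norm ?lee_fin; last 2 first.
  - by rewrite /f !mulr_ge0 ?powR_ge0 ?invr_ge0 ?exprn_ge0 ?(ltW (pos _))// ltW.
  - by rewrite mulr_ge0 ?powR_ge0 ?expR_ge0.
  rewrite /f [leRHS](_ : _ = t `^ (s - 1) * (4 * (1 + t `^ s) ^- 2)).
    by rewrite ler_wpM2l ?powR_ge0.
  by field; rewrite !gt_eqF//.
- exact: integrable_EFinZ.
Qed.

(** This serves to show that [c_alpha] is nonzero; both of its Gamma arguments, [alpha / 2] and
    [(2 - alpha) / 2], lie in ]0, 1[. *)
Lemma Gamma_gt0 (s : R) : 0 < s -> s <= 1 -> 0 < Gamma s.
Proof.
move=> s0 s1; apply: Rintegral_gt0; last exact: integrable_Gamma_integrand.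
- exact: measurable_itv.
- by rewrite lebesgue_measure_itv/= ltry addye ?ltry.
- move=> t; rewrite /= in_itv/= andbT => t0.
  by rewrite mulr_gt0 ?powR_gt0 ?expR_gt0.
Qed.

(** * Monotonicity and convexity of negative powers *)

Lemma powRN_MVT (p a b : R) : 0 < a -> a < b ->
  exists2 z, a < z < b & a `^ (- p) - b `^ (- p) = p * z `^ (- p - 1) * (b - a).
Proof.
move=> a0 ab.
have dpow x : x \in `]a, b[ -> is_derive x 1 (fun x : R => x `^ (- p)) (- p * x `^ (- p - 1)).
  by rewrite in_itv/= => /andP[ax _]; apply: is_derive1_powR; rewrite (lt_trans a0).
have cpow : {within `[a, b], continuous (fun x : R => x `^ (- p))}.
  apply: derivable_within_continuous => x; rewrite in_itv/= => /andP[ax _].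
  by apply: derivable_powR; rewrite in_itv/= andbT (lt_le_trans a0).
have [z] := MVT ab dpow cpow; rewrite in_itv/= => zab e.
by exists z => //; rewrite -opprB e; ring.
Qed.

Lemma powRN_lt (p a b : R) : 0 < p -> 0 < a -> a < b -> b `^ (- p) < a `^ (- p).
Proof.
move=> p0 a0 ab; rewrite !powRN ltf_pV2 ?posrE ?powR_gt0//; last exact: lt_trans ab.
by rewrite gt0_ltr_powR// ?nnegrE ltW//; exact: lt_trans ab.
Qed.

(* By the mean value theorem applied on [[A - t, A - s]] and on [[A + s, A + t]]. *)
Lemma powRN_sym_lt (p A s t : R) : 0 < p -> 0 <= s -> s < t -> t < A ->
  (A - s) `^ (- p) + (A + s) `^ (- p) < (A - t) `^ (- p) + (A + t) `^ (- p).
Proof.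
move=> p0 s0 st tA.
have [||z /andP[z1 z2] ez] := @powRN_MVT p (A - t) (A - s); [lra|lra|].
have [||w /andP[w1 w2] ew] := @powRN_MVT p (A + s) (A + t); [lra|lra|].
have wz : w `^ (- p - 1) < z `^ (- p - 1).
  by rewrite -opprD; apply: powRN_lt; lra.
have : 0 < p * (t - s) * (z `^ (- p - 1) - w `^ (- p - 1)).
  by rewrite !mulr_gt0// subr_gt0.
have -> : p * (t - s) * (z `^ (- p - 1) - w `^ (- p - 1)) =
  p * z `^ (- p - 1) * ((A - s) - (A - t)) - p * w `^ (- p - 1) * ((A + t) - (A + s)) by ring.
by rewrite -ez -ew; lra.
Qed.

(** Each side is even, since a change of sign swaps its two summands, so the case of nonnegative [s]
    and [t] suffices. *)
Lemma powRN_sym_lt_norm (p A s t : R) : 0 < p -> `|s| < `|t| -> `|t| < A ->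
  (A - s) `^ (- p) + (A + s) `^ (- p) < (A - t) `^ (- p) + (A + t) `^ (- p).
Proof.
have H x : (A - x) `^ (- p) + (A + x) `^ (- p) = (A - `|x|) `^ (- p) + (A + `|x|) `^ (- p).
  by case: (ler0P x) => // _; rewrite opprK addrC.
by move=> p0 st tA; rewrite (H s) (H t); exact: powRN_sym_lt.
Qed.

(** * The normal velocity kernel and its asymmetry under [u |-> pi - u] *)

Definition normal_kernel (p A B u y : R) : R :=
  sin y * (2 - 2 * cos y) `^ (- p) * (A - B * cos (u - y)) `^ (- p).

Lemma measurable_sine : measurable_fun [set: R] (@sin R).
Proof. by apply: continuous_measurable_fun; exact: continuous_sin. Qed.

Lemma measurable_cosine : measurable_fun [set: R] (@cos R).
Proof. by apply: continuous_measurable_fun; exact: continuous_cos. Qed.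

Lemma measurable_normal_kernel (p A B u : R) : measurable_fun [set: R] (normal_kernel p A B u).
Proof.
have mc : measurable_fun [set: R] (fun y : R => cos (u - y)).
  by apply: (measurableT_comp measurable_cosine); exact: measurable_funB.
apply: measurable_funM; first apply: measurable_funM.
- exact: measurable_sine.
- apply: (measurableT_comp (measurable_powR _)); apply: measurable_funB => //.
  by apply: measurable_funM => //; exact: measurable_cosine.
- apply: (measurableT_comp (measurable_powR _)); apply: measurable_funB => //.
  by apply: measurable_funM.
Qed.

(** The reflection [y |-> 2 pi - y] flips the sign of the sine and keeps the cosine, which produces
    the differences in [u - y] and [u + y]; [y |-> pi - y] keeps the sine and flips the cosine,
    which produces the weight in [2 + 2 * cos y]. *)
Lemma normal_kernel_fold (p A B u y : R) :
  let k := normal_kernel p A B u in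
  k y + k (2 * pi - y) + (k (pi - y) + k (2 * pi - (pi - y))) =
  sin y * (2 - 2 * cos y) `^ (- p) *
    ((A - B * cos (u - y)) `^ (- p) - (A - B * cos (u + y)) `^ (- p)) +
  sin y * (2 + 2 * cos y) `^ (- p) *
    ((A + B * cos (u + y)) `^ (- p) - (A + B * cos (u - y)) `^ (- p)).
Proof.
have s2 (x : R) : sin (2 * pi + x) = sin x by rewrite addrC mulr_natl sinD2pi.
have c2 (x : R) : cos (2 * pi + x) = cos x by rewrite addrC mulr_natl cosD2pi.
have e1 : u - (2 * pi - y) = (u + y) - 2 * pi by ring.
have e2 : u - (pi - y) = (u + y) - pi by ring.
have e3 : 2 * pi - (pi - y) = y + pi by ring.
have e4 : u - (y + pi) = (u - y) - pi by ring.
have cB (x : R) : cos (x - pi) = - cos x by rewrite -[x in RHS](subrK pi) cosDpi opprK.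
have sB (x : R) : sin (pi - x) = sin x by rewrite addrC sinDpi sinN opprK.
have cB' (x : R) : cos (pi - x) = - cos x by rewrite addrC cosDpi cosN.
have c2B (x : R) : cos (x - 2 * pi) = cos x by rewrite -(c2 (x - _)); congr cos; ring.
rewrite /= /normal_kernel s2 c2 e1 e2 e3 e4 c2B !cB cB' sB sinDpi cosDpi sinN cosN !mulrN !opprK.
ring.
Qed.

Lemma Rintegral_normal_kernel_lt (p A B u : R) : 0 < p -> B != 0 -> `|B| < A ->
  0 < u < pi / 2 ->
  mu.-integrable `[0, 2 * pi]%classic (EFin \o normal_kernel p A B u) ->
  mu.-integrable `[0, 2 * pi]%classic (EFin \o normal_kernel p A B (pi - u)) ->
  \int[mu]_(y in `[0, 2 * pi]%classic) normal_kernel p A B (pi - u) y <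
  \int[mu]_(y in `[0, 2 * pi]%classic) normal_kernel p A B u y.
Proof.
move=> p0 B0 BA /andP[u0 u2] i1 i2.
have pi0 : 0 < pi :> R := pi_gt0 R.
have pi20 : 0 < pi / 2 :> R by lra.
have pi22 : pi = 2 * (pi / 2) :> R by field.
pose fold (v : R) (y : R) := let k := normal_kernel p A B v in
  k y + k (2 * pi - y) + (k (pi - y) + k (2 * pi - (pi - y))).
have fold4 v : mu.-integrable `[0, 2 * pi]%classic (EFin \o normal_kernel p A B v) ->
   mu.-integrable `[0, pi / 2]%classic (EFin \o fold v) /\
   \int[mu]_(y in `[0, 2 * pi]%classic) normal_kernel p A B v y =
   \int[mu]_(y in `[0, pi / 2]%classic) fold v y.
  move=> iv; have mk := measurable_normal_kernel p A B v.
  have [iv1 ->] := Rintegral_fold pi0 erefl mk iv.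
  apply: (Rintegral_fold pi20 pi22 _ iv1).
  apply: measurable_funD => //; apply: measurableT_comp => //; exact: measurable_reflect.
have [j1 ->] := fold4 _ i1; have [j2 ->] := fold4 _ i2.
(* The endpoints are removed because the difference of the folded kernels vanishes there:
   [sin y = 0] at [0], and the two weights agree at [pi / 2]. *)
have io v : mu.-integrable `[0, pi / 2]%classic (EFin \o fold v) ->
    mu.-integrable `]0, pi / 2[%classic (EFin \o fold v) /\
   \int[mu]_(y in `[0, pi / 2]%classic) fold v y = \int[mu]_(y in `]0, pi / 2[%classic) fold v y.
  move=> j.
  have jc : mu.-integrable `]0, pi / 2]%classic (EFin \o fold v).
    by apply: integrableS j => //; exact: subset_itv_oc_cc.
  have jo : mu.-integrable `]0, pi / 2[%classic (EFin \o fold v).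
    by apply: integrableS j => //; exact: subset_itv_oo_cc.
  by rewrite (Rintegral_itv_bndo_bndc jo) (Rintegral_itv_obnd_cbnd jc).
have [k1 ->] := io _ j1; have [k2 ->] := io _ j2.
rewrite -subr_gt0 -RintegralB//; apply: Rintegral_gt0 => //.
- rewrite lebesgue_measure_itv/= lte_fin pi20 -EFinB lte_fin; lra.
- move=> y; rewrite /= in_itv/= => /andP[y0 y2].
  rewrite /fold !normal_kernel_fold.
  have cB (x : R) : cos (pi - x) = - cos x by rewrite addrC cosDpi cosN.
  have -> : pi - u - y = pi - (u + y) by ring.
  have -> : pi - u + y = pi - (u - y) by ring.
  rewrite !cB !mulrN !opprK.
  have sy : 0 < sin y by apply: sin_gt0_pi; apply/andP; split; lra.
  have cy : 0 < cos y by apply: cos_gt0_pihalf; apply/andP; split; lra.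
  have su : 0 < sin u by apply: sin_gt0_pi; apply/andP; split; lra.
  have cu : 0 < cos u by apply: cos_gt0_pihalf; apply/andP; split; lra.
  have cy1 : cos y < 1.
    rewrite lt_neqAle cos_le1 andbT; apply/eqP => c1.
    by have := cos2Dsin2 y; rewrite c1; nra.
  have W : (2 + 2 * cos y) `^ (- p) < (2 - 2 * cos y) `^ (- p) by apply: powRN_lt => //; lra.
  (* The squares of the cosines differ by [4 * (cos u * cos y * sin u * sin y)], positive because
     [u] and [y] lie in ]0, pi/2[. *)
  have lt_norm : `|B * cos (u + y)| < `|B * cos (u - y)|.
    rewrite -ltr_sqr ?nnegrE// !real_normK ?num_real// !exprMn ltr_pM2l; last first.
      by rewrite lt_neqAle sqr_ge0 eq_sym sqrf_eq0 B0.
    rewrite cosD cosB -subr_gt0.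
    have -> : (cos u * cos y + sin u * sin y) ^+ 2 - (cos u * cos y - sin u * sin y) ^+ 2 =
      4 * (cos u * cos y * sin u * sin y) by ring.
    by rewrite !mulr_gt0.
  have lt_A : `|B * cos (u - y)| < A.
    by rewrite normrM (le_lt_trans _ BA)// ler_piMr// cos_max.
  have H := powRN_sym_lt_norm p0 lt_norm lt_A.
  set a1 := (A - B * cos (u - y)) `^ (- p) in H *; set a2 := (A + B * cos (u - y)) `^ (- p) in H *.
  set b1 := (A - B * cos (u + y)) `^ (- p) in H *; set b2 := (A + B * cos (u + y)) `^ (- p) in H *.
  set w1 := (2 + _) `^ _ in W *; set w2 := (2 - _) `^ _ in W *.
  (* Expanded, this product is exactly [fold u y - fold (pi - u) y]. *)
  have : 0 < sin y * (w2 - w1) * ((a1 + a2) - (b1 + b2)).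
    by rewrite !mulr_gt0 ?subr_gt0.
  lra.
- have : mu.-integrable `]0, pi / 2[%classic ((EFin \o fold u) \- (EFin \o fold (pi - u)%R))%E.
    exact: integrableB.
  exact: eq_integrable.
Qed.

(** * Integrability of the chord singularity *)

Lemma sin_cos_half (y : R) : sin y = 2 * sin (y / 2) * cos (y / 2) /\
  cos y = 1 - 2 * sin (y / 2) ^+ 2.
Proof.
have e : y = (y / 2) *+ 2 by rewrite -mulr_natl; field.
split; first by rewrite {1}e sin_mulr2n; ring.
by rewrite {1}e cos_mulr2n cos2sin2; ring.
Qed.

(* As [(s c)^-p = (s c)^-p (s^2 + c^2) <= s^-p c + c^-p s] for [s = sin (y/4)] and
   [c = cos (y/4)], this function dominates a negative power of the chord
   [2 sin (y/2) = 4 s c], and it has the bounded primitive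
   [4 / (1 - p) (s^(1-p) - c^(1-p))]. *)
Lemma integrable_quarter (p : R) : 0 < p -> p < 1 ->
  mu.-integrable `]0, 2 * pi[%classic (EFin \o (fun y =>
    sin (y / 4) `^ (- p) * cos (y / 4) + cos (y / 4) `^ (- p) * sin (y / 4))).
Proof.
move=> p0 p1.
have pi0 : 0 < pi :> R := pi_gt0 R.
have sy (y : R) : 0 < y < 2 * pi -> 0 < sin (y / 4).
  by move=> /andP[? ?]; apply: sin_gt0_pi; apply/andP; split; lra.
have cy (y : R) : 0 < y < 2 * pi -> 0 < cos (y / 4).
  by move=> /andP[? ?]; apply: cos_gt0_pihalf; apply/andP; split; lra.
have d4 (y : R) : is_derive y 1 (fun y => y / 4) (1 / 4).
  have h := is_deriveM (is_derive_id y 1) (is_derive_cst (4^-1 : R) y 1).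
  by apply: (is_derive_eq h); rewrite scaler0 add0r; exact: mulrC.
have ds (y : R) : is_derive y 1 (fun y => sin (y / 4)) (cos (y / 4) * (1 / 4)).
  exact: is_derive1_comp (is_derive_sin _) (d4 y).
have dc (y : R) : is_derive y 1 (fun y => cos (y / 4)) (- sin (y / 4) * (1 / 4)).
  exact: is_derive1_comp (is_derive_cos _) (d4 y).
have dps r (y : R) : 0 < y < 2 * pi -> is_derive y 1 (fun y => sin (y / 4) `^ r)
    (r * sin (y / 4) `^ (r - 1) * (cos (y / 4) * (1 / 4))).
  by move=> /sy h; exact: is_derive1_comp (is_derive1_powR _ h) (ds y).
have dpc r (y : R) : 0 < y < 2 * pi -> is_derive y 1 (fun y => cos (y / 4) `^ r)
    (r * cos (y / 4) `^ (r - 1) * (- sin (y / 4) * (1 / 4))).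
  by move=> /cy h; exact: is_derive1_comp (is_derive1_powR _ h) (dc y).
have cont (f : R -> R) (y df : R) : is_derive y 1 f df -> {for y, continuous f}.
  by move=> h; apply: differentiable_continuous; apply/derivable1_diffP; exact: ex_derive.
apply: (@integrable_bounded_primitive_oo (2 * pi) _
  (fun y => 4 / (1 - p) * (sin (y / 4) `^ (1 - p) - cos (y / 4) `^ (1 - p))) (4 / (1 - p))).
- lra.
- move=> y y02; apply: cvgD; apply: cvgM.
  + exact: cont (dps _ _ y02).
  + exact: cont (dc _).
  + exact: cont (dpc _ _ y02).
  + exact: cont (ds _).
- by move=> y y02; rewrite addr_ge0// mulr_ge0 ?powR_ge0// ltW ?sy ?cy.
- move=> y y02.
  have h := is_deriveZ (4 / (1 - p)) (is_deriveB (dps (1 - p) _ y02) (dpc (1 - p) _ y02)).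
  apply: (is_derive_eq h); rewrite /GRing.scale/= (_ : 1 - p - 1 = - p); last by ring.
  by field; rewrite subr_eq0 gt_eqF.
- move=> y y02.
  have le1 (x : R) : 0 < x -> x <= 1 -> 0 <= x `^ (1 - p) <= 1.
    move=> x0 x1; rewrite powR_ge0/= (@le_trans _ _ (1 `^ (1 - p)))//; last by rewrite powR1.
    by rewrite ge0_ler_powR// ?nnegrE//; lra.
  have /andP[? ?] := le1 _ (sy _ y02) (sin_le1 _).
  have /andP[? ?] := le1 _ (cy _ y02) (cos_le1 _).
  rewrite normrM ger0_norm ?divr_ge0//; last by lra.
  rewrite ler_piMr ?divr_ge0//; first by lra.
  by rewrite ler_norml; lra.
Qed.

Lemma powRD_gt0 (x r s : R) : 0 < x -> x `^ (r + s) = x `^ r * x `^ s.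
Proof. by move=> x0; rewrite powRD// (gt_eqF x0) implybT. Qed.

(** With [t = 2 sin (y/2)] the bound is [K t^(1-2p) = K t^(1-p) t^-p]. The factor [t^(1-p)] is
    bounded, and [t^-p] is dominated by the function of [integrable_quarter]. *)
Lemma integrable_chord (p K : R) (f : R -> R) : 0 < p -> p < 1 -> 0 <= K ->
  measurable_fun [set: R] f ->
  (forall y, `|f y| <= K * Num.sqrt (2 - 2 * cos y) * (2 - 2 * cos y) `^ (- p)) ->
  mu.-integrable `[0, 2 * pi]%classic (EFin \o f).
Proof.
move=> p0 p1 K0 mf fK.
have pi0 : 0 < pi :> R := pi_gt0 R.
suff fo : mu.-integrable `]0, 2 * pi[%classic (EFin \o f).
  apply/integrableP; split; first by apply/measurable_EFinP; exact: measurable_funTS.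
  move/integrableP : fo => [_]; apply: le_lt_trans; rewrite integral_itv_bndoo//.
  by apply: measurableT_comp => //; apply/measurable_EFinP; exact: measurable_funTS.
pose g y := sin (y / 4) `^ (- p) * cos (y / 4) + cos (y / 4) `^ (- p) * sin (y / 4).
apply: (@le_integrable _ _ _ mu _ _ _ (EFin \o (fun y => 3 * K * g y))) => //.
- by apply/measurable_EFinP; exact: measurable_funTS.
- move=> y; rewrite /= in_itv/= => /andP[y0 y2].
  have s0 : 0 < sin (y / 4) by apply: sin_gt0_pi; apply/andP; split; lra.
  have c0 : 0 < cos (y / 4) by apply: cos_gt0_pihalf; apply/andP; split; lra.
  rewrite lee_fin [leRHS]ger0_norm; last first.
    by rewrite !mulr_ge0// addr_ge0// mulr_ge0 ?powR_ge0// ltW.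
  apply: le_trans (fK y) _.
  have [s2 _] := sin_cos_half (y / 2); have [_ c1] := sin_cos_half y.
  have e4 : y / 2 / 2 = y / 4 by field.
  rewrite e4 in s2.
  set s := sin (y / 4) in s0 s2 *; set c := cos (y / 4) in c0 s2 *.
  have s1 : s <= 1 := sin_le1 _.
  have c1' : c <= 1 := cos_le1 _.
  have sc0 : 0 < s * c by rewrite mulr_gt0.
  pose t := 4 * (s * c).
  have t0 : 0 < t by rewrite mulr_gt0.
  have -> : 2 - 2 * cos y = t ^+ 2 by rewrite c1 s2 /t; ring.
  rewrite sqrtr_sqr gtr0_norm//.
  have t2 : (t ^+ 2) `^ (- p) = t `^ (- p) * t `^ (- p).
    by rewrite expr2 powRM// ltW.
  have tt : t * t `^ (- p) = t `^ (1 - p).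
    by rewrite powRD_gt0// powRr1// ltW.
  rewrite t2 mulrA -(mulrA K) tt.
  (* From [2 s c <= s^2 + c^2 = 1] comes [t <= 2], hence [t^(1-p) <= 1 + t <= 3]. *)
  have b1 : t `^ (1 - p) <= 3.
    have := @le_powR_1D (1 - p) t; have : t <= 2.
      by have := sqr_ge0 (s - c); have := cos2Dsin2 (y / 4); rewrite -/s -/c /t; nra.
    by move=> ? /(_ _ _ _) H; have := H ltac:(lra) ltac:(lra) ltac:(lra); lra.
  have b2 : t `^ (- p) <= g y.
    have le1 (x : R) : 0 < x -> x <= 1 -> x ^+ 2 <= x `^ (1 + p).
      by move=> x0 x1; rewrite -powR_mulrn; [apply: ger_powR; [rewrite x0|lra]|exact: ltW].
    have split1 (x : R) : 0 < x -> x = x `^ (- p) * x `^ (1 + p).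
      move=> x0; rewrite -powRD_gt0//.
      by rewrite (_ : - p + (1 + p) = 1) ?powRr1 ?ltW//; ring.
    (* The last factor is at least [c^2 + s^2 = 1], because [1 + p < 2] and [s], [c] are at most
       1. *)
    have -> : g y = (s * c) `^ (- p) * (c `^ (1 + p) + s `^ (1 + p)).
      rewrite /g -/s -/c powRM ?(ltW s0) ?(ltW c0)//.
      transitivity (s `^ (- p) * (c `^ (- p) * c `^ (1 + p)) +
          c `^ (- p) * (s `^ (- p) * s `^ (1 + p))); last by ring.
      by rewrite -(split1 _ c0) -(split1 _ s0).
    have tsc : t `^ (- p) <= (s * c) `^ (- p).
      by apply/ltW/powRN_lt => //; rewrite /t; lra.
    apply: le_trans tsc _; rewrite ler_peMr ?powR_ge0//.
    have := le1 _ c0 c1'; have := le1 _ s0 s1; have := cos2Dsin2 (y / 4); rewrite -/s -/c; lra.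
  rewrite (_ : 3 * K * g y = K * 3 * g y); last by ring.
  by rewrite ler_pM ?mulr_ge0 ?powR_ge0// ler_wpM2l.
- by apply: integrable_EFinZ => //; exact: integrable_quarter.
Qed.

End RealAnalysis.

(** * Chords of the ellipse and its normal velocity *)

Section EllipseVelocity.
Set Implicit Arguments. Unset Strict Implicit. Unset Printing Implicit Defensive.
Context {R : realType}.
Notation mu := (@lebesgue_measure R).
Variables R1 R2 : R.
Hypotheses (R1_gt0 : 0 < R1) (R2_gt0 : 0 < R2).
Let A := (R1 ^+ 2 + R2 ^+ 2) / 2.
Let B := (R1 ^+ 2 - R2 ^+ 2) / 2.

(** Here [A + B] and [A - B] are the squares of [R1] and [R2], both positive. *)
Lemma normB_lt : `|B| < A.
Proof.
have := exprn_gt0 2 R1_gt0; have := exprn_gt0 2 R2_gt0.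
by rewrite /A /B ltr_norml => *; apply/andP; split; lra.
Qed.

Lemma ABcos_ge (w : R) : A - `|B| <= A - B * cos w.
Proof.
rewrite lerD2l lerN2 (le_trans (ler_norm _))// normrM.
by rewrite ler_piMr// cos_max.
Qed.

Lemma chord_ge0 (y : R) : 0 <= 2 - 2 * cos y.
Proof. by have := cos_le1 y; lra. Qed.

(** Around the mid-parameter [m = x - y/2], with [h = y/2], the chord is
    [2 sin h (- R1 sin m, R2 cos m)], and [R1^2 sin^2 m + R2^2 cos^2 m = A - B cos 2m]. *)
Lemma euclid_chord (x y : R) :
  euclid (ell R1 R2 x - ell R1 R2 (x - y)) =
  Num.sqrt ((2 - 2 * cos y) * (A - B * cos (2 * x - y))).
Proof.
rewrite /euclid /ell /=; congr Num.sqrt.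
pose m := x - y / 2; pose h := y / 2.
have -> : 2 * x - y = m + m by rewrite /m; field.
have -> : x - y = m - h by rewrite /m /h; field.
have -> : x = m + h by rewrite /m /h; ring.
have -> : cos y = 1 - 2 * sin h ^+ 2 by case: (sin_cos_half y).
(* Inserting [cos m ^+ 2 + sin m ^+ 2] next to [A] makes the identity polynomial in the sines and
   cosines of [m] and [h]. *)
have -> : (2 - 2 * (1 - 2 * sin h ^+ 2)) * (A - B * cos (m + m)) =
    4 * sin h ^+ 2 * (A * (cos m ^+ 2 + sin m ^+ 2) - B * cos (m + m)).
  by rewrite cos2Dsin2; ring.
by rewrite !(cosD, sinD, cosN, sinN) /A /B; field.
Qed.

Lemma chord_powRV (alpha x y : R) :
  ((euclid (ell R1 R2 x - ell R1 R2 (x - y))) `^ alpha)^-1 =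
  (2 - 2 * cos y) `^ (- (alpha / 2)) * (A - B * cos (2 * x - y)) `^ (- (alpha / 2)).
Proof.
have G0 : 0 <= A - B * cos (2 * x - y).
  by rewrite (le_trans _ (ABcos_ge _))// subr_ge0 ltW// normB_lt.
rewrite euclid_chord -powR12_sqrt ?mulr_ge0 ?chord_ge0// -powRrM -powRN.
rewrite (_ : - (2^-1 * alpha) = - (alpha / 2)); last by rewrite mulrC.
by rewrite powRM ?chord_ge0.
Qed.

(** This is the squared chord of the unit circle; each coordinate difference of the tangent [dell]
    is therefore at most a semi-axis times its square root. *)
Lemma chord_sqr (x y : R) :
  (cos x - cos (x - y)) ^+ 2 + (sin x - sin (x - y)) ^+ 2 = 2 - 2 * cos y.
Proof.
have -> : cos y = cos x * cos (x - y) + sin x * sin (x - y).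
  by rewrite -cosB; congr cos; ring.
have -> : (cos x - cos (x - y)) ^+ 2 + (sin x - sin (x - y)) ^+ 2 =
   (cos x ^+ 2 + sin x ^+ 2) + (cos (x - y) ^+ 2 + sin (x - y) ^+ 2) -
   2 * (cos x * cos (x - y) + sin x * sin (x - y)) by ring.
by rewrite !cos2Dsin2; ring.
Qed.

(** The ellipse factor is at least [A - |B| > 0], so its negative power is bounded and only the
    singularity of the circle chord remains, with [p = alpha / 2 < 1]. *)
Lemma integrable_patch (alpha x : R) (comp : R * R -> R) (K : R) :
  0 < alpha -> alpha < 2 -> 0 <= K ->
  measurable_fun [set: R] (fun y => comp (dell R1 R2 y)) ->
  (forall y, `|comp (dell R1 R2 x) - comp (dell R1 R2 (x - y))| <=
     K * Num.sqrt (2 - 2 * cos y)) ->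
  mu.-integrable `[0, 2 * pi]%classic (EFin \o patch_integrand R1 R2 alpha x comp).
Proof.
move=> a0 a2 K0 mc cK.
have p0 : 0 < alpha / 2 by lra.
have m0 : 0 < A - `|B| by rewrite subr_gt0 normB_lt.
have E y : patch_integrand R1 R2 alpha x comp y =
    (comp (dell R1 R2 x) - comp (dell R1 R2 (x - y))) *
    ((2 - 2 * cos y) `^ (- (alpha / 2)) * (A - B * cos (2 * x - y)) `^ (- (alpha / 2))).
  by rewrite /patch_integrand chord_powRV.
have G (w : R) : (A - B * cos w) `^ (- (alpha / 2)) <= (A - `|B|) `^ (- (alpha / 2)).
  have := ABcos_ge w; rewrite le_eqVlt => /predU1P[->//|h].
  by apply/ltW/powRN_lt.
apply: (@integrable_chord _ (alpha / 2) (K * (A - `|B|) `^ (- (alpha / 2)))) => //.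
- lra.
- by rewrite mulr_ge0// powR_ge0.
- rewrite (funext E).
  apply: measurable_funM.
    apply: measurable_funB => //.
    by apply: (measurableT_comp mc); exact: measurable_funB.
  apply: measurable_funM; apply: (measurableT_comp (measurable_powR _));
    apply: measurable_funB => //.
    by apply: measurable_funM => //; exact: measurable_cosine.
  apply: measurable_funM => //; apply: (measurableT_comp measurable_cosine).
  exact: measurable_funB.
- move=> y; rewrite E normrM [X in _ * X]ger0_norm ?mulr_ge0 ?powR_ge0//.
  rewrite (_ : K * _ * _ * _ = (K * Num.sqrt (2 - 2 * cos y)) *
    ((2 - 2 * cos y) `^ (- (alpha / 2)) * (A - `|B|) `^ (- (alpha / 2)))); last by ring.
  by rewrite ler_pM ?mulr_ge0 ?powR_ge0// ler_wpM2l ?powR_ge0.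
Qed.

(** The tangent at [x] is orthogonal to its own [perp], so only the tangent at [x - y] contributes,
    giving [R1 R2 sin y]. Both coordinates are shown integrable first, so that the integrals may be
    combined linearly. *)
Lemma patch_normal_velocity (alpha theta1 theta2 x : R) : 0 < alpha -> alpha < 2 ->
  mu.-integrable `[0, 2 * pi]%classic (EFin \o normal_kernel (alpha / 2) A B (2 * x)) /\
  dot (patch_velocity alpha theta1 theta2 R1 R2 x) (perp (dell R1 R2 x)) =
  c_alpha alpha theta1 theta2 * (R1 * R2) *
    \int[mu]_(y in `[0, 2 * pi]%classic) normal_kernel (alpha / 2) A B (2 * x) y.
Proof.
move=> a0 a2.
have le_sqrt (a b : R) : `|a| <= Num.sqrt (b ^+ 2 + a ^+ 2).
  by rewrite -sqrtr_sqr ler_wsqrtr// lerDr sqr_ge0.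
have i1 : mu.-integrable `[0, 2 * pi]%classic (EFin \o patch_integrand R1 R2 alpha x fst).
  apply: (@integrable_patch _ _ _ R1) => //; first exact: ltW.
    rewrite (_ : (fun y => _) = (fun y => - R1 * sin y)); last first.
      by apply/funext => y /=; rewrite mulNr.
    by apply: measurable_funM => //; exact: measurable_sine.
  move=> y; rewrite /dell/= (_ : _ - _ = R1 * - (sin x - sin (x - y))); last by ring.
  by rewrite normrM gtr0_norm// ler_pM2l// normrN -(chord_sqr x y).
have i2 : mu.-integrable `[0, 2 * pi]%classic (EFin \o patch_integrand R1 R2 alpha x snd).
  apply: (@integrable_patch _ _ _ R2) => //; first exact: ltW.
    apply: measurable_funM => //; exact: measurable_cosine.
  move=> y; rewrite /dell/= -mulrBr.
  by rewrite normrM gtr0_norm// ler_pM2l// -(chord_sqr x y) [X in Num.sqrt X]addrC.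
have comb y : R1 * R2 * normal_kernel (alpha / 2) A B (2 * x) y =
    - (R2 * cos x) * patch_integrand R1 R2 alpha x fst y +
    - (R1 * sin x) * patch_integrand R1 R2 alpha x snd y.
  rewrite /normal_kernel /patch_integrand chord_powRV /dell/=.
  have -> : sin y = sin x * cos (x - y) - cos x * sin (x - y).
    by rewrite -sinB; congr sin; ring.
  by ring.
have j1 : mu.-integrable `[0, 2 * pi]%classic
    (EFin \o (fun y => - (R2 * cos x) * patch_integrand R1 R2 alpha x fst y)).
  exact: integrable_EFinZ.
have j2 : mu.-integrable `[0, 2 * pi]%classic
    (EFin \o (fun y => - (R1 * sin x) * patch_integrand R1 R2 alpha x snd y)).
  exact: integrable_EFinZ.
have R12 : R1 * R2 != 0 by rewrite mulf_neq0// gt_eqF.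
have ik : mu.-integrable `[0, 2 * pi]%classic (EFin \o normal_kernel (alpha / 2) A B (2 * x)).
  have := integrable_EFinZ (R1 * R2)^-1 (measurable_itv _)
    (integrable_EFinD (measurable_itv _) j1 j2).
  by apply: eq_integrable => // y _ /=; rewrite -comb mulKf.
split => //.
rewrite -mulrA -RintegralZl//.
under eq_Rintegral do rewrite comb.
rewrite RintegralD// !RintegralZl// /dot /patch_velocity /perp /dell/=.
by ring.
Qed.
End EllipseVelocity.

(** * Nonvanishing of the constant and the contradiction *)

Lemma c_alpha_neq0 (R : realType) (alpha theta1 theta2 : R) : 0 < alpha -> alpha < 2 ->
  theta1 != theta2 -> c_alpha alpha theta1 theta2 != 0.
Proof.
move=> a0 a2 t12.
have g1 : 0 < Gamma (alpha / 2) by apply: Gamma_gt0; lra.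
have g2 : 0 < Gamma ((2 - alpha) / 2) by apply: Gamma_gt0; lra.
rewrite /c_alpha; apply: mulf_neq0.
  by rewrite oppr_eq0 mulf_neq0 ?(gt_eqF g1)// subr_eq0 eq_sym.
by rewrite invr_eq0 gt_eqF// !mulr_gt0 ?powR_gt0 ?exprn_gt0 ?pi_gt0.
Qed.

Theorem theorem1 (R : realType) (alpha theta1 theta2 R1 R2 : R) :
  0 < alpha -> alpha < 2 -> theta1 != theta2 ->
  0 < R1 -> 0 < R2 -> R1 != R2 ->
  ~ (exists Omega : R, forall x : R, 0 <= x -> x <= 2 * pi ->
       dot (patch_velocity alpha theta1 theta2 R1 R2 x) (perp (dell R1 R2 x)) =
       dot (Omega *: perp (ell R1 R2 x)) (perp (dell R1 R2 x))).
Proof.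
move=> a0 a2 t12 R10 R20 R12 [W eqn].
have pi0 : 0 < (pi : R) by exact: pi_gt0.
have p0 : 0 < alpha / 2 by rewrite divr_gt0.
(* The points [pi / 8] and [pi / 2 - pi / 8] correspond, through [u = 2 x], to [u = pi / 4] and
   [pi - u]. *)
have [x1_ge0 x1_le] : 0 <= (pi : R) / 8 /\ (pi : R) / 8 <= 2 * pi by clear -pi0; split; lra.
have [x2_ge0 x2_le] : 0 <= (pi : R) / 2 - pi / 8 /\ (pi : R) / 2 - pi / 8 <= 2 * pi.
  by clear -pi0; split; lra.
have u_bnd : 0 < (pi : R) / 4 < pi / 2 by clear -pi0; apply/andP; split; lra.
have [i1 v1] := patch_normal_velocity R10 R20 theta1 theta2 (pi / 8) a0 a2.
have [i2 v2] := patch_normal_velocity R10 R20 theta1 theta2 (pi / 2 - pi / 8) a0 a2.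
have e1 : 2 * (pi / 8) = pi / 4 :> R by field.
have e2 : 2 * (pi / 2 - pi / 8) = pi - pi / 4 :> R by field.
rewrite e1 in i1 v1; rewrite e2 in i2 v2.
(* The rotation term equals [W (R2^2 - R1^2) sin x cos x], which is invariant under
   [x |-> pi / 2 - x]. *)
have rhs : dot (W *: perp (ell R1 R2 (pi / 2 - pi / 8))) (perp (dell R1 R2 (pi / 2 - pi / 8))) =
    dot (W *: perp (ell R1 R2 (pi / 8))) (perp (dell R1 R2 (pi / 8))).
  rewrite /dot /perp /dell /ell/= /GRing.scale/=.
  rewrite sinB cosB sin_pihalf cos_pihalf !mul0r !mul1r ?add0r ?subr0.
  by ring.
have q1 := eqn _ x1_ge0 x1_le; have q2 := eqn _ x2_ge0 x2_le.
have c0 : c_alpha alpha theta1 theta2 * (R1 * R2) != 0.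
  apply: mulf_neq0; first exact: c_alpha_neq0.
  by apply: mulf_neq0; rewrite gt_eqF.
have /(mulfI c0)/eqP := etrans (esym v2) (etrans q2 (etrans rhs (etrans (esym q1) v1))).
rewrite lt_eqF//.
apply: Rintegral_normal_kernel_lt => //.
- by rewrite mulf_neq0 ?invr_neq0// subr_eq0 eqrXn2// ltW.
- exact: normB_lt.
Qed.
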